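(* Let $Q\in\mathbb{R}^{n\times n}$, let $P$ be an $n\times n$ permutation matrix, and let $\boldsymbol{x}\in S_Q(P)$ be such that $x_i\neq x_j$ and $(Q\boldsymbol{x})_i\neq(Q\boldsymbol{x})_j$ for all $i\neq j$. Then there exists $\epsilon>0$ such that $\mathbb{B}_\epsilon(\boldsymbol{x})\subset S_Q(P)$, where $\mathbb{B}_\epsilon(\boldsymbol{x})=\{\boldsymbol{y}\in\mathbb{R}^n:\|\boldsymbol{y}-\boldsymbol{x}\|_{\rm F}^2<\epsilon\}$.
   Context: $\mathsf{P}$ is the set of $n\times n$ permutation matrices. On column vectors the Frobenius norm $\|\cdot\|_{\rm F}$ is the Euclidean norm. For $P^*\in\mathsf{P}$, the permutation set of $P^*$ is $$S_Q(P^* )=\{\boldsymbol{x}_0\in\mathbb{R}^n:\ P^*=\arg\min_{P\in\mathsf{P}}\|Q\boldsymbol{x}_0-P\boldsymbol{x}_0\|_{\rm F}^2\},$$ where ''$P^*=\arg\min$'' means that $P^*$ attains the minimum over $\mathsf{P}$ (the minimiser need not be unique; e.g. $\boldsymbol{0}\in S_Q(P)$ for every $P\in\mathsf{P}$). *)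

(* Defs.v *)
From mathcomp Require Import all_boot all_order all_algebra.
From mathcomp Require Import boolp classical_sets reals.

Set Implicit Arguments.
Unset Strict Implicit.
Unset Printing Implicit Defensive.

Import Order.TTheory GRing.Theory Num.Theory.
Local Open Scope classical_set_scope.
Local Open Scope ring_scope.

(* Not the norm `|A| that MathComp-Analysis puts on matrices, which is the
   maximum of the absolute values of the entries. *)
Definition frobenius (R : realType) (m n : nat) (A : 'M[R]_(m, n)) : R :=
  Num.sqrt (\sum_(i < m) \sum_(j < n) `|A i j| ^+ 2).

Definition perm_mxs (R : realType) (n : nat) : set 'M[R]_n :=
  [set P | is_perm_mx P].

(* The minimiser a is not required to be unique. *)
Definition is_argmin (T : Type) (R : realType) (D : set T) (f : T -> R)
    (a : T) : Prop :=
  D a /\ forall b, D b -> f a <= f b.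

Definition permutation_set (R : realType) (n : nat) (Q Pstar : 'M[R]_n) :
    set 'cV[R]_n :=
  [set x0 | is_argmin (@perm_mxs R n)
              (fun P => frobenius (Q *m x0 - P *m x0) ^+ 2) Pstar].

(* The bound e is on the squared norm: e is the squared radius of the ball. *)
Definition sq_ball (R : realType) (n : nat) (e : R) (x : 'cV[R]_n) :
    set 'cV[R]_n :=
  [set y | frobenius (y - x) ^+ 2 < e].

(* Main.v *)
Require Import Defs.
From mathcomp Require Import all_boot all_order all_algebra.
From mathcomp Require Import boolp classical_sets reals.
From mathcomp Require Import fingroup perm lra.

(** A minimiser over permutations pairs the entries of [Q x] with those of [x]
    in the same order: otherwise exchanging two entries would lower the cost.
    When all entries are distinct only one permutation sorts [x] like [Q x],
    and it remains the sorting one near [x], because strict inequalities between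
    entries of [x] and of [Q x] persist on a ball.  A minimiser at [y] near [x]
    must sort [y] like [Q y] too, so it is the same permutation. *)

Set Implicit Arguments.
Unset Strict Implicit.
Unset Printing Implicit Defensive.

Import Order.TTheory GRing.Theory Num.Theory.
Local Open Scope classical_set_scope.
Local Open Scope ring_scope.

Lemma frobenius_cV_sqr (R : realType) (n : nat) (v : 'cV[R]_n) :
  frobenius v ^+ 2 = \sum_i v i 0 ^+ 2.
Proof.
rewrite sqr_sqrtr; last by do 2![apply: sumr_ge0 => ? _]; rewrite exprn_ge0.
by apply: eq_bigr => i _; rewrite big_ord1 real_normK ?num_real.
Qed.

Lemma perm_cost (R : realType) (n : nat) (b y : 'cV[R]_n) (s : 'S_n) :
  frobenius (b - perm_mx s *m y) ^+ 2 = \sum_i (b i 0 - y (s i) 0) ^+ 2.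
Proof.
by rewrite frobenius_cV_sqr; apply: eq_bigr => i _; rewrite -row_permE !mxE.
Qed.

(** Exchanging the images of [i] and [j] under [s] changes the cost by
    [2 * (b j - b i) * (a (s j) - a (s i))], which cannot be negative at a minimiser. *)
Lemma optimal_perm_sorts (R : realType) (T : finType) (b a : T -> R)
    (s : {perm T}) :
    (forall t : {perm T},
      \sum_i (b i - a (s i)) ^+ 2 <= \sum_i (b i - a (t i)) ^+ 2) ->
  forall i j, b i < b j -> a (s i) <= a (s j).
Proof.
move=> smin i j ltb; have nij : j != i.
  by apply: contraTneq ltb => ->; rewrite ltxx.
have split2 (F : T -> R) :
    \sum_k F k = F i + (F j + \sum_(k | (k != i) && (k != j)) F k).
  by rewrite (bigD1 i) //= (bigD1 j).
have := smin (tperm i j * s)%g.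
rewrite !split2 !permM tpermL tpermR.
set r := (X in _ + (_ + X) <= _); set r' := (X in _ <= _ + (_ + X)).
have -> : r' = r.
  apply: eq_bigr => k /andP[ki kj].
  by rewrite permM tpermD // eq_sym.
by nra.
Qed.

(** Sorting forces the rank of [a (u i)] among the values of [a] to be that of [b i] among the
    values of [b], whichever sorting [u] is taken. Since [a] inherits injectivity from [b], a rank
    determines its index. *)
Lemma sorting_perm_unique (R : realType) (T : finType) (b a : T -> R)
    (s t : {perm T}) :
    injective b ->
    (forall i j, b i < b j -> a (s i) < a (s j)) ->
    (forall i j, b i < b j -> a (t i) < a (t j)) ->
  s = t.
Proof.
move=> injb ss st; pose below (f : T -> R) x := [set k | f k < f x]%SET.
have rank (u : {perm T}) : (forall i j, b i < b j -> a (u i) < a (u j)) ->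
    forall i, #|below a (u i)| = #|below b i|.
  move=> su i; rewrite -(card_preimset _ (@perm_inj _ u)).
  apply: eq_card => k; rewrite !inE.
  case: (ltgtP (b k) (b i)) => [/su //|/su/ltW|/injb ->]; last by rewrite ltxx.
  by rewrite leNgt => /negbTE.
have rank_mono k l : a k < a l ->
    (#|below a k| < #|below a l|)%N.
  move=> akl; apply: proper_card; apply/properP; split.
    by apply/fintype.subsetP => m; rewrite !inE => /lt_trans; apply.
  by exists k; rewrite inE // ltxx.
have inja : injective a.
  move=> k l; rewrite -(permKV s k) -(permKV s l) => eqa; congr (s _).
  apply: injb; case: (ltgtP (b (s^-1%g k)) (b (s^-1%g l))) => // /ss;
  by rewrite eqa ltxx.
apply/permP => i; apply: inja.
by case: (ltgtP (a (s i)) (a (t i))) => // /rank_mono; rewrite !rank // ltnn.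
Qed.

Lemma le_sq_ball (R : realType) (n : nat) (e e' : R) (x : 'cV[R]_n) :
  e <= e' -> sq_ball e x `<=` sq_ball e' x.
Proof. by move=> le_e y /lt_le_trans; apply. Qed.

Lemma linear_form_gt0_ball (R : realType) (n : nat) (w : 'rV[R]_n)
    (x : 'cV[R]_n) :
    0 < (w *m x) 0 0 ->
  exists2 e, 0 < e & forall y, sq_ball e x y -> 0 < (w *m y) 0 0.
Proof.
(* On a ball of radius [r] the form changes by at most [r] times the sum of the [|w 0 k|]. The
   summand 1 in [c] makes this strictly less than [c * r], the value at [x]. *)
move=> wx_gt0; pose c := 1 + \sum_k `|w 0 k|.
have c_gt0 : 0 < c by rewrite ltr_pwDl ?ltr01 ?sumr_ge0.
pose r := (w *m x) 0 0 / c; have r_gt0 : 0 < r by rewrite divr_gt0.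
exists (r ^+ 2) => [|y]; first by rewrite exprn_gt0.
rewrite /sq_ball /= frobenius_cV_sqr => ballxy.
have coord k : `|(y - x) k 0| <= r.
  rewrite -ler_sqr ?nnegrE ?(ltW r_gt0) // real_normK ?num_real //.
  apply: le_trans (ltW ballxy).
  by rewrite (bigD1 k) //= lerDl sumr_ge0 // => i _; rewrite sqr_ge0.
have diff_lt : `|(w *m (y - x)) 0 0| < (w *m x) 0 0.
  rewrite mxE; apply: (@le_lt_trans _ _ (\sum_k `|w 0 k| * r)).
    apply: le_trans (ler_norm_sum _ _ _) _; apply: ler_sum => k _.
    by rewrite normrM ler_wpM2l.
  have -> : (w *m x) 0 0 = c * r by rewrite mulrC divfK ?gt_eqF.
  by rewrite -mulr_suml ltr_pM2r // ltrDr ltr01.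
move: diff_lt; rewrite mulmxBr !mxE ltr_norml => /andP[+ _].
by lra.
Qed.

Lemma finite_common_ball (R : realType) (n : nat) (I : finType)
    (x : 'cV[R]_n) (A : I -> set 'cV[R]_n) :
    (forall i, exists2 e, 0 < e & sq_ball e x `<=` A i) ->
  exists2 e, 0 < e & forall i, sq_ball e x `<=` A i.
Proof.
move=> Aball; have /choice[e he] : forall i, exists e,
  0 < e /\ sq_ball e x `<=` A i by move=> i; have [e] := Aball i; exists e.
(* The default 1 keeps the radius positive when [I] is empty. *)
exists (\big[Order.min/1]_i e i) => [|i].
  by apply: lt_bigmin => // i _; have [] := he i.
apply: subset_trans (proj2 (he i)); apply: le_sq_ball.
exact: bigmin_le_cond.
Qed.

(** Each strict comparison is the positivity of the linear form [row j A - row i A], and there are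
    finitely many pairs. A general [A] covers the entries of both [Q x] and [x], the latter through
    the identity matrix. *)
Lemma strict_order_ball (R : realType) (m n : nat) (A : 'M[R]_(m, n))
    (x : 'cV[R]_n) :
  exists2 e, 0 < e & forall y, sq_ball e x y ->
    forall i j, (A *m x) i 0 < (A *m x) j 0 -> (A *m y) i 0 < (A *m y) j 0.
Proof.
have rowE i j (y : 'cV_n) :
    ((row j A - row i A) *m y) 0 0 = (A *m y) j 0 - (A *m y) i 0.
  by rewrite mulmxBl -!row_mul !mxE.
have [|e e_gt0 he] := @finite_common_ball R n ('I_m * 'I_m)%type x
    (fun p => [set y | (A *m x) p.1 0 < (A *m x) p.2 0 ->
                       (A *m y) p.1 0 < (A *m y) p.2 0]).
  move=> [i j] /=; case: (ltP ((A *m x) i 0) ((A *m x) j 0)) => [ltx|_].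
    have [|e e_gt0 he] := @linear_form_gt0_ball R n (row j A - row i A) x.
      by rewrite rowE subr_gt0.
    by exists e => // y /he; rewrite rowE subr_gt0 => lty _.
  by exists 1.
by exists e => // y exy i j; apply: (he (i, j)).
Qed.

Theorem proposition4 (R : realType) (n : nat) (Q P : 'M[R]_n) (x : 'cV[R]_n)
    (hP : perm_mxs P)
    (hx : permutation_set Q P x)
    (hdist : forall i j : 'I_n, i != j ->
      x i 0 <> x j 0 /\ (Q *m x) i 0 <> (Q *m x) j 0) :
  exists eps : R, 0 < eps /\ sq_ball eps x `<=` permutation_set Q P.
Proof.
case/is_perm_mxP: hP hx => s -> [_ smin].
have injx : injective (fun i => x i 0).
  by move=> i j eqx; apply/eqP/negP => /negP /hdist[].
have injQx : injective (fun i => (Q *m x) i 0).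
  by move=> i j eqQ; apply/eqP/negP => /negP /hdist[].
have [e1 e1_gt0 Qball] := strict_order_ball Q x.
have [e2 e2_gt0 Iball] := strict_order_ball 1%:M x.
exists (Order.min e1 e2); split=> [|y ball_y]; first by rewrite lt_min e1_gt0.
have Qy : forall i j, (Q *m x) i 0 < (Q *m x) j 0 ->
    (Q *m y) i 0 < (Q *m y) j 0.
  by apply: Qball; apply: le_sq_ball ball_y; rewrite ge_min lexx.
have xy : forall i j, x i 0 < x j 0 -> y i 0 < y j 0.
  have := Iball y; rewrite !mul1mx; apply.
  by apply: le_sq_ball ball_y; rewrite ge_min lexx orbT.
have injy : injective (fun i => y i 0).
  move=> i j /= eqy; apply: injx => /=.
  by case: (ltgtP (x i 0) (x j 0)) => // /xy; rewrite eqy ltxx.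
pose cost (t : 'S_n) := \sum_i ((Q *m y) i 0 - y (t i) 0) ^+ 2.
pose t := [arg min_(u < s) cost u]%O.
have tmin u : cost t <= cost u.
  by rewrite /t; case: arg_minP => // v _; apply.
(* Optimality yields only a weak inequality; distinctness of the entries of [x] makes it strict. *)
have sortx i j : (Q *m x) i 0 < (Q *m x) j 0 -> x (s i) 0 < x (s j) 0.
  move=> ltQ; rewrite lt_neqAle; apply/andP; split.
    by apply: contraTneq ltQ => /injx/perm_inj ->; rewrite ltxx.
  apply: (@optimal_perm_sorts R _ (fun i => (Q *m x) i 0) (fun i => x i 0))
    ltQ => u; rewrite -!perm_cost; apply: smin; exact: perm_mx_is_perm.
(* Both permutations sort [y] by the order of [Q x]: [s] because [y] is ordered like [x], and [t],
   optimal at [y], because [Q y] is ordered like [Q x]. *)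
have <- : t = s.
  apply: (@sorting_perm_unique R _ (fun i => (Q *m x) i 0) (fun i => y i 0))
    => // i j ltQ; last exact/xy/sortx.
  rewrite lt_neqAle; apply/andP; split.
    by apply: contraTneq ltQ => /injy/perm_inj ->; rewrite ltxx.
  apply: (@optimal_perm_sorts R _ (fun i => (Q *m y) i 0) (fun i => y i 0))
    => //; exact: Qy.
split=> [|_ /is_perm_mxP[u ->]]; first exact: perm_mx_is_perm.
by rewrite !perm_cost; apply: tmin.
Qed.
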